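(* Let $h\in\mathcal H=\operatorname{span}_{\mathbb C}(H)$ range over the functions in the complex span of the components of $H$, let $h\circ\mathcal T$ be its evolution and let $\mathfrak P_{h\circ\mathcal T}$ be its predictor built from the data. Assume that $\Psi(X,U)$ and $H(X^+)$ have full row rank. Define, for $h\in\mathcal H$, $h\neq 0$, the relative root mean square error on the data $$\operatorname{RRMSE}_{h\circ\mathcal T}=\sqrt{\frac{\frac1N\sum_{i=1}^N|h\circ\mathcal T(x_i,u_i)-\mathfrak P_{h\circ\mathcal T}(x_i,u_i)|^2}{\frac1N\sum_{i=1}^N|h\circ\mathcal T(x_i,u_i)|^2}}=\sqrt{\frac{\sum_{i=1}^N|h(x_i^+)-\mathfrak P_{h\circ\mathcal T}(x_i,u_i)|^2}{\sum_{i=1}^N|h(x_i^+)|^2}} .$$ Then $$\max_{h\in\mathcal H,\ h\neq 0}\operatorname{RRMSE}_{h\circ\mathcal T}=\sqrt{\mathcal I_{CC}},$$ where $\mathcal I_{CC}=\lambda_{\max}(M_{CC})$ is the control consistency index.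
   Context: System: $x^+=\mathcal T(x,u)$ with $\mathcal T:\mathcal X\times\mathcal U\to\mathcal X$, $\mathcal X\subseteq\mathbb R^n$, $\mathcal U\subseteq\mathbb R^m$. Normal basis: $H:\mathcal X\to\mathbb R^{n_{\mathcal H}}$ and a matrix-valued function $G:\mathcal U\to\mathbb R^{(n_\Psi-n_{\mathcal H})\times n_{\mathcal H}}$ are given, and $\Psi:\mathcal X\times\mathcal U\to\mathbb R^{n_\Psi}$ is $\Psi(x,u)=\begin{bmatrix}I\\ G(u)\end{bmatrix}H(x)$, with $I$ the $n_{\mathcal H}\times n_{\mathcal H}$ identity; the components of $\Psi$ are linearly independent functions. Data: $X,X^+\in\mathbb R^{n\times N}$, $U\in\mathbb R^{m\times N}$ with columns $x_i\in\mathcal X$, $x_i^+$, $u_i\in\mathcal U$ satisfying $x_i^+=\mathcal T(x_i,u_i)$, $i=1,\dots,N$. Write $\Psi(X,U)=[\Psi(x_1,u_1),\dots,\Psi(x_N,u_N)]$, $\Psi(X^+,U)=[\Psi(x_1^+,u_1),\dots,\Psi(x_N^+,u_N)]$, $H(X^+)=[H(x_1^+),\dots,H(x_N^+)]$. $^\dagger$ is the Moore–Penrose pseudoinverse and $^*$ the conjugate transpose. Predictor: let $A=\Psi(X^+,U)\Psi(X,U)^\dagger$ (the unique minimizer of $\|\Psi(X^+,U)-K\Psi(X,U)\|_F$ over $K$), partitioned as $A=\begin{bmatrix}A_{11}&A_{12}\\ A_{21}&A_{22}\end{bmatrix}$ with $A_{11}\in\mathbb R^{n_{\mathcal H}\times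 n_{\mathcal H}}$. For $h=v_h^*H$ with $v_h\in\mathbb C^{n_{\mathcal H}}$, the predictor is $\mathfrak P_{h\circ\mathcal T}(x,u)=v_h^*\,(A_{11}+A_{12}G(u))\,H(x)$. Control consistency matrix: $A_f=H(X^+)\Psi(X,U)^\dagger$, $A_b=\Psi(X,U)H(X^+)^\dagger$, and $M_{CC}=I-A_fA_b\in\mathbb R^{n_{\mathcal H}\times n_{\mathcal H}}$. Under the full-row-rank assumption its eigenvalues are real, and $\lambda_{\max}(M_{CC})$ denotes the largest one. *)

(* Defs.v *)
From HB Require Import structures.
From mathcomp Require Import all_boot all_order all_algebra.
From mathcomp Require Import boolp classical_sets reals.
From mathcomp Require Import complex.

Set Implicit Arguments.
Unset Strict Implicit.
Unset Printing Implicit Defensive.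

Import Order.TTheory GRing.Theory Num.Theory.
Local Open Scope ring_scope.
Local Open Scope classical_set_scope.
Local Open Scope complex_scope.
Local Open Scope sesquilinear_scope.

Definition is_max {d} {T : porderType d} (S : set T) (m : T) : Prop :=
  S m /\ ubound S m.

(* The four Penrose equations; the matrices are real, so the conjugate
   transpose is the transpose. *)
Definition is_pseudoinverse (R : realType) m n
    (A : 'M[R]_(m, n)) (B : 'M[R]_(n, m)) : Prop :=
  [/\ A *m B *m A = A, B *m A *m B = B,
      (A *m B)^T = A *m B & (B *m A)^T = B *m A].

(* [is_pseudoinverse A] holds of exactly one matrix, so the default value of
   [xget] is irrelevant. *)
Definition pseudoinverse (R : realType) m n (A : 'M[R]_(m, n)) : 'M[R]_(n, m) :=
  xget 0 [set B | is_pseudoinverse A B].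

(* The maximum is taken over the complex spectrum of [M].  In the order of
   [R[i]], [z <= a%:C] means that [z] is real and at most [a]: [lambda_max M]
   is the largest eigenvalue when all eigenvalues are real (and [0], the
   default, otherwise). *)
Definition lambda_max (R : realType) n (M : 'M[R]_n) : R :=
  xget 0 [set a : R |
    is_max [set z : R[i] | eigenvalue (map_mx (real_complex R) M) z] a%:C].

Definition lin_indep_components (R : realType) (P : Type) k
    (F : P -> 'cV[R]_k) : Prop :=
  forall c : 'rV[R]_k, (forall z, c *m F z = 0) -> c = 0.

(* The matrix [F(z_1), ..., F(z_N)]. *)
Definition data_mx (R : realType) (P : Type) k N
    (F : P -> 'cV[R]_k) (z : 'I_N -> P) : 'M[R]_(k, N) :=
  \matrix_(j < k, i < N) F (z i) j 0.

Section ControlConsistency.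

Context {R : realType} {n m nH p N : nat}.
Context {X : set 'cV[R]_n} {U : set 'cV[R]_m}.

(* [p] is the number of rows of [G u], so that [Psi] has [nH + p] components. *)
Definition normal_basis (H : X -> 'cV[R]_nH) (G : U -> 'M[R]_(p, nH))
    (z : X * U) : 'cV[R]_(nH + p) :=
  col_mx 1%:M (G z.2) *m H z.1.

(* The function [v^* H]. *)
Definition span_fun (H : X -> 'cV[R]_nH) (v : 'cV[R[i]]_nH) (x : X) : R[i] :=
  (v^t* *m map_mx (real_complex R) (H x)) 0 0.

Definition Psi_data (H : X -> 'cV[R]_nH) (G : U -> 'M[R]_(p, nH))
    (x : 'I_N -> X) (u : 'I_N -> U) : 'M[R]_(nH + p, N) :=
  data_mx (normal_basis H G) (fun i => (x i, u i)).

Definition edmd_mx (H : X -> 'cV[R]_nH) (G : U -> 'M[R]_(p, nH))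
    (x xp : 'I_N -> X) (u : 'I_N -> U) : 'M[R]_(nH + p) :=
  Psi_data H G xp u *m pseudoinverse (Psi_data H G x u).

(* The predictor of [h \o T] for [h = span_fun H v]. *)
Definition predictor (H : X -> 'cV[R]_nH) (G : U -> 'M[R]_(p, nH))
    (x xp : 'I_N -> X) (u : 'I_N -> U) (v : 'cV[R[i]]_nH) (z : X * U) : R[i] :=
  let A := edmd_mx H G x xp u in
  (v^t* *m map_mx (real_complex R)
            ((ulsubmx A + ursubmx A *m G z.2) *m H z.1)) 0 0.

(* [ComplexField.normc] is the modulus as an element of [R]. *)
Definition RRMSE (x : 'I_N -> X) (u : 'I_N -> U) (f g : X * U -> R[i]) : R :=
  Num.sqrt
    ((N%:R^-1 * \sum_(i < N)
        ComplexField.Normc.normc (f (x i, u i) - g (x i, u i)) ^+ 2) /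
     (N%:R^-1 * \sum_(i < N)
        ComplexField.Normc.normc (f (x i, u i)) ^+ 2)).

Definition MCC (H : X -> 'cV[R]_nH) (G : U -> 'M[R]_(p, nH))
    (x xp : 'I_N -> X) (u : 'I_N -> U) : 'M[R]_nH :=
  let Af := data_mx H xp *m pseudoinverse (Psi_data H G x u) in
  let Ab := Psi_data H G x u *m pseudoinverse (data_mx H xp) in
  1%:M - Af *m Ab.

Definition ICC (H : X -> 'cV[R]_nH) (G : U -> 'M[R]_(p, nH))
    (x xp : 'I_N -> X) (u : 'I_N -> U) : R :=
  lambda_max (MCC H G x xp u).

End ControlConsistency.

(* Main.v *)
Require Import Defs.
From mathcomp Require Import all_boot all_order all_algebra.
From mathcomp Require Import boolp classical_sets reals.
From mathcomp Require Import complex.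
Local Open Scope ring_scope.
Local Open Scope classical_set_scope.
Local Open Scope complex_scope.

(** Let [Y = H(X^+)], [P = Psi(X,U)] and let [Q = P^+ P], an orthogonal
    projection; write [A'] for the conjugate transpose of [A].  The squared RRMSE
    of [v' H] is the Rayleigh quotient of the pair [Y (1 - Q) Y'], [Y Y'] at [v],
    and [M_CC = Y (1 - Q) Y' (Y Y')^-1].  Orthonormalizing the rows of [Y] and
    applying the spectral theorem diagonalizes both forms at once:
    [Y Y' = V V'] and [Y (1 - Q) Y' = V D V'].  Hence [M_CC = V D V^-1], and the
    Rayleigh quotient is a weighted mean of the diagonal entries of [D], which
    are real. *)

Set Implicit Arguments.
Unset Strict Implicit.
Import Order.TTheory GRing.Theory Num.Theory.
Local Open Scope sesquilinear_scope.

Local Notation toC := (map_mx (real_complex _)).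

(** * Diagonalization of Hermitian pencils, and the spectrum read off from it *)

Section HermitianPencil.

Variable C : numClosedFieldType.

Lemma adjmx_mul m n p (A : 'M[C]_(m, n)) (B : 'M[C]_(n, p)) :
  (A *m B)^t* = B^t* *m A^t*.
Proof. by rewrite trmx_mul map_mxM. Qed.

Lemma simultaneous_diagonalization k N (Y : 'M[C]_(k, N)) (B : 'M[C]_N) :
  row_free Y -> B^t* = B ->
  exists (V : 'M[C]_k) (d : 'rV[C]_k),
    [/\ V \in unitmx, d \is a realmx, Y *m Y^t* = V *m V^t* &
        Y *m B *m Y^t* = V *m diag_mx d *m V^t*].
Proof.
move=> Yfree Bherm.
have leqkN : (k <= N)%N by rewrite -(eqP Yfree) rank_leq_col.
pose E := schmidt Y.
have Eu : E \is unitarymx := schmidt_unitarymx Y leqkN.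
have /submxP[L YE] : (Y <= E)%MS := schmidt_sub Y.
(* [Y = L E] has rank [k], and a product has at most the rank of its left factor, so the square
   matrix [L] is invertible. *)
have Lunit : L \in unitmx.
  rewrite -row_full_unit -col_leq_rank -{1}(eqP Yfree) YE.
  exact: mxrankM_maxl.
pose F := E *m B *m E^t*.
have Fherm : F \is hermsymmx.
  apply/is_hermitianmxP; rewrite expr0 scale1r.
  by rewrite /F !adjmx_mul trmxCK Bherm mulmxA.
have /orthomx_spectralP FE := hermitian_normalmx Fherm.
have Su : spectralmx F \is unitarymx := spectral_unitarymx F.
rewrite invmx_unitary // in FE.
(* With [S = spectralmx F] and [F = S' D S], one gets [Y B Y' = L F L' = (L S') D (L S')'], while
   [E E' = 1] and [S' S = 1] turn [Y Y'] into [(L S') (L S')']. *)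
exists (L *m (spectralmx F)^t*), (spectral_diag F); split.
- by rewrite unitmx_mul Lunit unitarymx_unit // trmxC_unitary.
- exact: hermitian_spectral_diag_real.
- rewrite {1 2}YE !adjmx_mul trmxCK !mulmxA mulmxtVK //.
  by rewrite mulmxKtV.
- rewrite YE !adjmx_mul trmxCK.
  transitivity (L *m F *m L^t*); first by rewrite /F !mulmxA.
  by rewrite [in LHS]FE !mulmxA.
Qed.

End HermitianPencil.

(** [eigenvalue] speaks of row eigenvectors: right multiplication by [V] carries those of [M] to
    those of [diag_mx d], and conversely the rows of the inverse of [V] are eigenvectors of [M]. *)
Lemma eigenvalue_diagonalized (F : fieldType) k (M V : 'M[F]_k) (d : 'rV[F]_k)
    (z : F) :
  V \in unitmx -> M *m V = V *m diag_mx d ->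
  reflect (exists j, z = d 0 j) (eigenvalue M z).
Proof.
move=> Vu MV; apply: (iffP eigenvalueP) => [[w wM w0]|[j ->]].
- have wV : w *m V *m diag_mx d = z *: (w *m V).
    by rewrite -mulmxA -MV mulmxA wM scalemxAl.
  have /rV0Pn[j wVj] : w *m V != 0.
    by apply: contraNneq w0 => /(congr1 (mulmx^~ (invmx V))); rewrite mulmxK // mul0mx => ->.
  exists j; apply: (mulIf wVj); have /rowP/(_ j) := wV.
  by rewrite mul_mx_diag mxE mulrC [in RHS]mxE.
- exists (delta_mx 0 j *m invmx V).
  + rewrite -[M](mulmxK Vu) MV !mulmxA mulmxKV // scalemxAl.
    congr (_ *m _); apply/matrixP=> a b; rewrite mul_mx_diag !mxE.
    by rewrite mulrC; case: (b =P j) => [->|]; rewrite ?andbF ?mulr0.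
  + apply/eqP => /(congr1 (mulmx^~ V)); rewrite mulmxKV // mul0mx.
    by move/rowP/(_ j); rewrite !mxE !eqxx => /eqP; rewrite oner_eq0.
Qed.

(** * Real matrices, their pseudoinverses, and real-valued forms on complex rows *)

Section RealData.

Variable R : realType.
Local Notation normc := (@ComplexField.Normc.normc R).

Lemma toC_adj m n (A : 'M[R]_(m, n)) : (toC A)^t* = toC A^T.
Proof. by apply/matrixP=> i j; rewrite !mxE; apply: conjc_real. Qed.

(** If [v A A^T = 0], then the squared norm of [v A] is zero; being a sum of real squares, it forces
    [v A = 0]. *)
Lemma gram_unit k N (A : 'M[R]_(k, N)) : row_free A -> A *m A^T \in unitmx.
Proof.
move=> Afree; rewrite -row_free_unit; apply: inj_row_free => v vAA.
have : v *m A *m (v *m A)^T = 0 by rewrite trmx_mul !mulmxA -(mulmxA v) vAA mul0mx.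
move/matrixP/(_ 0 0); rewrite !mxE => vA0.
apply: (row_free_inj Afree); rewrite mul0mx; apply/rowP => j; rewrite [RHS]mxE.
apply/eqP; rewrite -sqrf_eq0; apply/eqP.
have -> : (v *m A) 0 j ^+ 2 = (v *m A) 0 j * (v *m A)^T j 0 by rewrite [_^T _ _]mxE.
by apply: (psumr_eq0P _ vA0) => // i _; rewrite [_^T _ _]mxE -expr2 sqr_ge0.
Qed.

(** With full row rank, [A^T (A A^T)^-1] solves the Penrose equations, so [xget] picks a genuine
    solution and not its default. *)
Lemma pseudoinverseP k N (A : 'M[R]_(k, N)) :
  row_free A -> is_pseudoinverse A (pseudoinverse A).
Proof.
move=> /gram_unit Au; rewrite /pseudoinverse.
apply: (@xgetPex _ 0 [set B | is_pseudoinverse A B]).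
have AB : A *m (A^T *m invmx (A *m A^T)) = 1%:M by rewrite mulmxA mulmxV.
exists (A^T *m invmx (A *m A^T)); split; rewrite /= ?AB ?mul1mx ?trmx1 //.
  by rewrite -mulmxA AB mulmx1.
by rewrite !trmx_mul trmx_inv !trmx_mul !trmxK mulmxA.
Qed.

(** Stated as the image of a real sum, so that complex matrix identities transfer to the real sums
    in [RRMSE]. *)
Lemma diag_form k (d : 'rV[R]_k) (w : 'rV[R[i]]_k) :
  (w *m diag_mx (toC d) *m w^t*) 0 0
  = (\sum_j d 0 j * normc (w 0 j) ^+ 2)%:C.
Proof.
rewrite mxE rmorph_sum; apply: eq_bigr => j _.
rewrite mul_mx_diag !mxE /= rmorphM rmorphXn /=.
have -> : (normc (w 0 j))%:C = `|w 0 j| by [].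
by rewrite sqr_normc -mulrA mulrCA.
Qed.

Lemma norm_form k (w : 'rV[R[i]]_k) :
  (w *m w^t*) 0 0 = (\sum_j normc (w 0 j) ^+ 2)%:C.
Proof.
transitivity ((w *m diag_mx (toC (const_mx 1)) *m w^t*) 0 0).
  by rewrite map_const_mx rmorph1 diag_const_mx mulmx1.
rewrite diag_form; congr (_%:C); apply: eq_bigr => j _.
by rewrite mxE mul1r.
Qed.

Lemma norm_form_gt0 k (w : 'rV[R[i]]_k) :
  w != 0 -> 0 < \sum_j normc (w 0 j) ^+ 2.
Proof.
move=> /rV0Pn[j wj]; rewrite lt_neqAle sumr_ge0 ?andbT => [|i _]; last exact: sqr_ge0.
apply: contraNneq wj => /esym w0; apply/eqP/ComplexField.Normc.eq0_normc/eqP.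
by rewrite -sqrf_eq0; apply/eqP; apply: (psumr_eq0P _ w0) => // i _; apply: sqr_ge0.
Qed.

Lemma lambda_max_diagonalized k (M : 'M[R]_k) (V : 'M[R[i]]_k) (d : 'rV[R]_k)
    (j0 : 'I_k) :
  V \in unitmx -> toC M *m V = V *m diag_mx (toC d) ->
  (forall j, d 0 j <= d 0 j0) -> lambda_max M = d 0 j0.
Proof.
move=> Vu MV dmax; rewrite /lambda_max.
have evP z : reflect (exists j, z = toC d 0 j) (eigenvalue (toC M) z).
  exact: eigenvalue_diagonalized Vu MV.
have maxj0 : is_max [set z : R[i] | eigenvalue (toC M) z] (d 0 j0)%:C.
  split=> /=; first by apply/evP; exists j0; rewrite mxE.
  by move=> z /= /evP[j ->]; rewrite mxE lecR.
(* The value picked by [xget] and [d 0 j0] are both maxima of the spectrum, hence equal by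
   antisymmetry. *)
set S := [set _ | _]; have : S (xget 0 S) by apply: xgetPex; exists (d 0 j0).
move: (xget 0 S) => a [/= aev aub]; apply/eqP; rewrite eq_le.
case: maxj0 => /= jev jub.
by move: (aub _ jev) (jub _ aev); rewrite !lecR => -> ->.
Qed.

End RealData.

(** * The predictor on the data, and the matrix [MCC] *)

Section Predictor.

Context {R : realType} {n m nH p N : nat}.
Context {X : set 'cV[R]_n} {U : set 'cV[R]_m}.
Variables (T : X * U -> X) (H : X -> 'cV[R]_nH) (G : U -> 'M[R]_(p, nH)).
Variables (x xp : 'I_N -> X) (u : 'I_N -> U).
Hypothesis xpE : forall i : 'I_N, xp i = T (x i, u i).

Local Notation Y := (data_mx H xp).
Local Notation P := (Psi_data H G x u).
Local Notation B := (1%:M - pseudoinverse P *m P).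
Local Notation normc := (@ComplexField.Normc.normc R).

Lemma usub_Psi_data : usubmx (Psi_data H G xp u) = Y.
Proof.
apply/matrixP => i j; rewrite [LHS]mxE [LHS]mxE [RHS]mxE.
by rewrite /normal_basis mul_col_mx col_mxEu mul1mx.
Qed.

(** The upper block row of [edmd_mx] is [Y P^+], and column [i] of [P] is [[1; G(u_i)] H(x_i)]. On
    the data the predictor thus projects the rows of [Y] orthogonally onto the row space of [P]. *)
Lemma predictor_mx i :
  (ulsubmx (edmd_mx H G x xp u) + ursubmx (edmd_mx H G x xp u) *m G (u i))
    *m H (x i)
  = col i (Y *m pseudoinverse P *m P).
Proof.
have AE : row_mx (ulsubmx (edmd_mx H G x xp u)) (ursubmx (edmd_mx H G x xp u))
    = Y *m pseudoinverse P.
  by rewrite /ulsubmx /ursubmx hsubmxK /edmd_mx -mul_usub_mx usub_Psi_data.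
have PE : col i P = col_mx 1%:M (G (u i)) *m H (x i).
  by apply/colP => a; rewrite [LHS]mxE [LHS]mxE.
by rewrite colE -mulmxA -colE -AE PE mulmxA mul_row_col mulmx1.
Qed.

Lemma residual_mx (v : 'cV[R[i]]_nH) i :
  span_fun H v (T (x i, u i)) - predictor H G x xp u v (x i, u i)
  = (v^t* *m toC (Y *m B)) 0 i.
Proof.
rewrite /span_fun /predictor -xpE predictor_mx mulmxBr mulmx1 map_mxB mulmxBr mulmxA.
rewrite [RHS]mxE [in X in _ = _ + X]mxE.
by congr (_ - _); rewrite !mxE; apply: eq_bigr => j _; rewrite !mxE.
Qed.

Lemma span_fun_data (v : 'cV[R[i]]_nH) i :
  span_fun H v (xp i) = (v^t* *m toC Y) 0 i.
Proof. by rewrite /span_fun !mxE; apply: eq_bigr => j _; rewrite !mxE. Qed.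

Lemma RRMSE_span_fun (v : 'cV[R[i]]_nH) : (0 < N)%N ->
  RRMSE x u (fun z => span_fun H v (T z)) (predictor H G x xp u v)
  = Num.sqrt ((\sum_i normc ((v^t* *m toC (Y *m B)) 0 i) ^+ 2) /
              (\sum_i normc ((v^t* *m toC Y) 0 i) ^+ 2)).
Proof.
move=> N_gt0; rewrite /RRMSE -mulf_div divff ?mul1r; last first.
  by rewrite invr_eq0 pnatr_eq0 -lt0n.
congr (Num.sqrt (_ / _)); apply: eq_bigr => i _.
  by rewrite residual_mx.
by rewrite -xpE span_fun_data.
Qed.

Hypotheses (Psi_free : row_free P) (Y_free : row_free Y).

Lemma residual_projector : B^T = B /\ B *m B = B.
Proof.
have [_ PPP _ symP] := pseudoinverseP Psi_free; split.
  by rewrite linearB /= trmx1 symP.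
by rewrite mulmxBr mulmx1 mulmxBl mul1mx mulmxA PPP subrr subr0.
Qed.

(** The symmetry of [Y^+ Y] gives [Y^+ Y Y^T = Y^T], which removes the pseudoinverse of [Y] from
    [MCC]. *)
Lemma MCC_gram : MCC H G x xp u *m (Y *m Y^T) = Y *m B *m Y^T.
Proof.
have [YYY _ _ symY] := pseudoinverseP Y_free.
have YtE : pseudoinverse Y *m (Y *m Y^T) = Y^T.
  by rewrite mulmxA -symY -trmx_mul mulmxA YYY.
rewrite /MCC mulmxBl mul1mx mulmxBr mulmx1 mulmxBl.
by congr (_ - _); rewrite -!mulmxA YtE.
Qed.

(** In the coordinates [v' V] both sums of squares become diagonal. The residual enters through
    [Y B Y'] because [B] is symmetric and idempotent. *)
Lemma control_consistency_diagonalization :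
  exists (V : 'M[R[i]]_nH) (d : 'rV[R]_nH),
    [/\ V \in unitmx,
        toC (MCC H G x xp u) *m V = V *m diag_mx (toC d),
        forall v : 'cV[R[i]]_nH, \sum_i normc ((v^t* *m toC Y) 0 i) ^+ 2
          = \sum_j normc ((v^t* *m V) 0 j) ^+ 2 &
        forall v : 'cV[R[i]]_nH, \sum_i normc ((v^t* *m toC (Y *m B)) 0 i) ^+ 2
          = \sum_j d 0 j * normc ((v^t* *m V) 0 j) ^+ 2].
Proof.
have [Bsym Bidem] := residual_projector.
have YCfree : row_free (toC Y) by rewrite row_free_map.
have BCherm : (toC B)^t* = toC B by rewrite toC_adj Bsym.
have [V [d [Vu dreal YY YBY]]] := simultaneous_diagonalization YCfree BCherm.
have dE : d = toC (map_mx (@complex.Re R) d).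
  by apply/rowP => j; rewrite !mxE RRe_real //; apply: (mxOverP dreal).
rewrite dE in YBY.
have Vtu : V^t* \in unitmx by rewrite map_unitmx unitmx_tr.
exists V, (map_mx (@complex.Re R) d); split=> // [|v|v].
(* Multiplied on the right by [V'], both sides equal [Y B Y'], since [V V' = Y Y']; then the
   invertible [V'] is cancelled. *)
- rewrite -[LHS](mulmxK Vtu) -mulmxA -mulmxA (mulmxA V) -YY.
  rewrite !toC_adj -map_mxM mulmxA -map_mxM MCC_gram.
  by rewrite !map_mxM -toC_adj YBY mulmxK.
- apply: complexI; rewrite -!norm_form !adjmx_mul.
  by rewrite -mulmxA (mulmxA (toC Y)) YY !mulmxA.
- have YBE : toC (Y *m B) *m (toC (Y *m B))^t* = toC Y *m toC B *m (toC Y)^t*.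
    by rewrite !toC_adj -!map_mxM trmx_mul Bsym !mulmxA -(mulmxA Y B B) Bidem.
  apply: complexI; rewrite -norm_form -diag_form !(adjmx_mul (v^t*)).
  by rewrite -[in LHS]mulmxA (mulmxA (toC (Y *m B))) YBE YBY !mulmxA.
Qed.

End Predictor.

Unset Implicit Arguments.

Theorem theoremV1 (R : realType) (n m nH p N : nat)
  (X : set 'cV[R]_n) (U : set 'cV[R]_m) (T : X * U -> X)
  (H : X -> 'cV[R]_nH) (G : U -> 'M[R]_(p, nH))
  (x xp : 'I_N -> X) (u : 'I_N -> U)
  (nH_gt0 : (0 < nH)%N)
  (Psi_indep : lin_indep_components (normal_basis H G))
  (xpE : forall i : 'I_N, xp i = T (x i, u i))
  (Psi_full_rank : row_free (Psi_data H G x u))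
  (Hxp_full_rank : row_free (data_mx H xp)) :
  is_max
    [set r : R | exists (h : X -> R[i]) (v : 'cV[R[i]]_nH),
       [/\ h = span_fun H v,
           h <> (fun _ => 0) &
           r = RRMSE x u (fun z => h (T z)) (predictor H G x xp u v)]]
    (Num.sqrt (ICC H G x xp u)).
Proof.
(* Full row rank of [H(X^+)] forces [nH <= N]. *)
have N_gt0 : (0 < N)%N.
  by rewrite (leq_trans nH_gt0) // -(eqP Hxp_full_rank) rank_leq_col.
have [V [d [Vu MV denE numE]]] :=
  control_consistency_diagonalization Psi_full_rank Hxp_full_rank.
pose j0 := [arg max_(j > Ordinal nH_gt0) d 0 j]%O.
have dmax j : d 0 j <= d 0 j0.
  by rewrite /j0; case: arg_maxP => // k _; apply.
rewrite /ICC (lambda_max_diagonalized Vu MV dmax).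
split=> /=.
(* The maximizer: [v'] is the row eigenvector of [MCC] for [d 0 j0], so that [v' V] is a basis
   vector and all the weight sits on [d 0 j0]. *)
- pose v := ((delta_mx 0 j0 : 'rV_nH) *m invmx V)^t*.
  have wE : v^t* *m V = delta_mx 0 j0 by rewrite trmxCK mulmxKV.
  have w0 : v^t* *m V != 0.
    by rewrite wE; apply/rV0Pn; exists j0; rewrite mxE !eqxx oner_eq0.
  exists (span_fun H v), v; split=> // [h0|].
    (* A vanishing [h] would make the denominator zero, but it equals the positive squared norm of
       [v' V]. *)
    have := norm_form_gt0 w0; rewrite -denE big1 ?ltxx // => i _.
    by rewrite -span_fun_data h0 ComplexField.Normc.normc0 expr0n.
  rewrite RRMSE_span_fun // numE denE; congr Num.sqrt.
  apply: (mulIf (lt0r_neq0 (norm_form_gt0 w0))).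
  rewrite divfK ?lt0r_neq0 ?norm_form_gt0 // mulr_sumr; apply: eq_bigr => j _.
  rewrite wE mxE eqxx /=; case: (j =P j0) => [->//|_].
  by rewrite ComplexField.Normc.normc0 expr0n /= !mulr0.
- move=> _ [h [v [-> h0 ->]]]; rewrite RRMSE_span_fun // numE denE.
  (* Since [V] is invertible, [v' V = 0] would give [v = 0] and [h = 0]; so the denominator is
     positive and may be cleared. *)
  have w0 : v^t* *m V != 0.
    apply/eqP => w0; apply: h0; apply/funext => z.
    have v0 : v^t* = 0 by rewrite -[LHS](mulmxK Vu) w0 mul0mx.
    by rewrite /span_fun v0 mul0mx mxE.
  rewrite ler_wsqrtr // ler_pdivrMr ?norm_form_gt0 // mulr_sumr.
  by apply: ler_sum => j _; rewrite ler_wpM2r ?sqr_ge0.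
Qed.
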